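(* Let $n\in\mathbb{N}$ and let $\chi$ be a primitive Dirichlet character (mod $n$). Let $f:\mathbb{Z}\to\mathbb{C}$ be an even function (mod $n$) and let $s\in\mathbb{Z}$. Then $$\sum_{k=1}^n f(k-s)\,\chi(k)=(\mu*f)(n)\,\chi(s).$$
   Context: $\mathbb{N}$ is the set of positive integers. $(a,b)$ denotes the greatest common divisor (nonnegative, with $(0,n)=n$ for $n\in\mathbb{N}$). For fixed $n\in\mathbb{N}$, a function $f:\mathbb{Z}\to\mathbb{C}$ is called an even function (mod $n$) if $f((k,n))=f(k)$ for every $k\in\mathbb{Z}$. $\mu$ is the Möbius function and $*$ is Dirichlet convolution of arithmetic functions, so $(\mu*f)(n)=\sum_{ab=n}\mu(a)f(b)$, the sum being over positive integers $a,b$ with $ab=n$ (here $f$ is restricted to positive integers). *)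

(* Defs.v *)
From mathcomp Require Import all_boot all_order all_algebra.
From mathcomp Require Import reals.
From mathcomp Require Import complex.
Set Implicit Arguments.
Unset Strict Implicit.
Unset Printing Implicit Defensive.
Import Order.TTheory GRing.Theory Num.Theory.
Local Open Scope ring_scope.

(* The complex numbers are R[i] for R : realType; a Dirichlet character mod n is
   extended by zero to all of int, and chi 1 = 1 follows from the axioms below. *)

(* gcdz is the nonnegative gcd on int, with gcdz 0 n = n. *)
Definition even_mod (R : realType) (n : nat) (f : int -> R[i]) : Prop :=
  forall k : int, f (gcdz k n%:Z) = f k.

Definition dirichlet_character (R : realType) (n : nat) (chi : int -> R[i])
    : Prop :=
  [/\ forall k : int, chi (k + n%:Z) = chi k,
      forall j k : int, chi (j * k) = chi j * chi k
    & forall k : int, chi k != 0 <-> coprimez k n%:Z].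

Definition induced_by (R : realType) (n : nat) (chi psi : int -> R[i])
    : Prop :=
  forall k : int, coprimez k n%:Z -> chi k = psi k.

(* Primitive: not induced by a character to a proper divisor of the modulus.
   The unique character mod 1 is primitive. *)
Definition primitive_character (R : realType) (n : nat) (chi : int -> R[i])
    : Prop :=
  dirichlet_character n chi /\
  forall (d : nat) (psi : int -> R[i]),
    (d %| n)%N -> (d < n)%N -> dirichlet_character d psi ->
    ~ induced_by n chi psi.

(* Arithmetic functions live on nat; their value at 0 is irrelevant. *)
Definition mobius (n : nat) : int :=
  if all (fun p => logn p n == 1%N) (primes n)
  then (-1) ^+ size (primes n) else 0.

Definition dirichlet_conv (A : pzSemiRingType) (g h : nat -> A) (n : nat) : A :=
  \sum_(a <- divisors n) g a * h (n %/ a)%N.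

(* Main.v *)
(* Writing [f k = \sum_(b %| (k, n)) f b * [(k, n) = b]] and detecting the
   equality by [\sum_(a %| m) mobius a = [m = 1]], the left-hand side becomes the
   sum of [mobius a * f b * T (a * b)] over [a * b %| n], where [T d] is the sum of
   [chi] over the residues mod n that are congruent to s mod d.  Primitivity makes
   [T d] vanish for d < n: there is a unit c = 1 mod d with chi c <> 1, and
   multiplication by c permutes these residues, so [chi c * T d = T d].
   Only [T n = chi s] survives. *)
Require Import Defs.
From mathcomp Require Import all_boot all_order all_algebra.
From mathcomp Require Import reals.
From mathcomp Require Import complex.
Set Implicit Arguments.
Unset Strict Implicit.
Unset Printing Implicit Defensive.
Import Order.TTheory GRing.Theory Num.Theory.
Local Open Scope ring_scope.

(** * Divisor sums of the Möbius function *)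

(** If p divides e, its exponent in [p * e] is at least 2; otherwise p is one extra simple prime,
    which flips the sign. *)
Lemma mobius_primeM (p e : nat) : prime p -> (0 < e)%N ->
  mobius (p * e) = if (p %| e)%N then 0 else - mobius e.
Proof.
move=> pp e0; have p0 := prime_gt0 pp.
have pe q : q \in primes (p * e) = (q \in p :: primes e).
  by rewrite primesM // primes_prime // !inE.
rewrite /mobius; case: (boolP (p %| e)%N) => pe_dvd.
  rewrite ifN //; apply/allPn; exists p; first by rewrite pe inE eqxx.
  by rewrite lognM // logn_prime // eqxx add1n eqSS -lt0n logn_gt0 mem_primes pp e0.
have uq : uniq (p :: primes e).
  by rewrite /= primes_uniq mem_primes (negPf pe_dvd) !andbF.
have /perm_size -> : perm_eq (primes (p * e)) (p :: primes e).
  by apply: uniq_perm => //; exact: primes_uniq.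
rewrite (eq_all_r pe) /= lognM // logn_prime // eqxx.
have -> : logn p e = 0%N.
  by apply/eqP; rewrite -leqn0 leqNgt logn_gt0 mem_primes (negPf pe_dvd) !andbF.
rewrite /= (eq_in_all (a2 := fun q => logn q e == 1%N)); last first.
  move=> q; rewrite mem_primes => /and3P[pq _ qe].
  rewrite lognM // logn_prime //; have [pq'|//] := eqVneq q p.
  by move: pe_dvd; rewrite -pq' qe.
by case: ifP => _; rewrite ?oppr0 // exprS mulN1r.
Qed.

(** For m > 1, fix a prime p dividing m. Divisors [p * e] with p dividing e contribute 0; the others
    contribute [- mobius e] and cancel the divisors of m prime to p. *)
Lemma sum_mobius_divisors (m : nat) : (0 < m)%N ->
  \sum_(a <- divisors m) mobius a = (m == 1%N)%:R.
Proof.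
move=> m0; have [->|m1] := eqVneq m 1%N.
  by rewrite big_cons big_nil.
have m_gt1 : (1 < m)%N by rewrite ltn_neqAle eq_sym m1.
have [p pp pm] : exists2 p, prime p & (p %| m)%N.
  by exists (pdiv m); rewrite ?pdiv_prime ?pdiv_dvd.
have p0 := prime_gt0 pp.
have mp0 : (0 < m %/ p)%N by rewrite divn_gt0 // dvdn_leq.
rewrite (bigID (fun a => p %| a)%N) /=.
rewrite -big_filter (perm_big [seq (p * e)%N | e <- divisors (m %/ p)]) /=; last first.
  apply: uniq_perm.
  - by rewrite filter_uniq ?divisors_uniq.
  - rewrite map_inj_uniq ?divisors_uniq // => x y /eqP.
    by rewrite eqn_pmul2l ?prime_gt0 // => /eqP.
  move=> x; rewrite mem_filter -dvdn_divisors //; apply/andP/mapP.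
    case=> px xm; exists (x %/ p)%N; last by rewrite mulnC divnK.
    by rewrite -dvdn_divisors // -(dvdn_pmul2r p0) !divnK.
  case=> e; rewrite -dvdn_divisors // => em ->.
  rewrite dvdn_mulr //; split=> //.
  by rewrite -(divnK pm) mulnC dvdn_pmul2r ?prime_gt0.
rewrite big_map (bigID (fun a => p %| a)%N) /= big_seq_cond big1 ?add0r; last first.
  move=> e /andP[]; rewrite -dvdn_divisors // => /(dvdn_gt0 mp0) e0 pe.
  by rewrite mobius_primeM // pe.
rewrite -big_filter -[X in _ + X]big_filter.
rewrite (perm_big [seq a <- divisors m | ~~ (p %| a)%N]) /=; last first.
  apply: uniq_perm; rewrite ?filter_uniq ?divisors_uniq // => x.
  rewrite !mem_filter -!dvdn_divisors //; case: (boolP (p %| x)%N) => //= px.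
  by rewrite -{2}(divnK pm) Gauss_dvdl // coprime_sym prime_coprime.
rewrite -big_split big_seq big1 // => e.
rewrite mem_filter -dvdn_divisors // => /andP[/negPf pe em].
by rewrite mobius_primeM ?(dvdn_gt0 m0) // pe /= addNr.
Qed.

(** For fixed b dividing g, a runs over the divisors of [g %/ b], so the Möbius sum leaves only b =
    g. Letting a and b range over divisors of n keeps the index sets independent of g, so that these
    sums can be exchanged with a sum in which g varies. *)
Lemma mobius_expand (A : pzRingType) (h : nat -> A) (g n : nat) :
  (0 < n)%N -> (g %| n)%N ->
  h g = \sum_(a <- divisors n) \sum_(b <- divisors n | (a * b %| g)%N)
          (mobius a)%:~R * h b.
Proof.
move=> n0 gn; have g0 : (0 < g)%N := dvdn_gt0 n0 gn.
rewrite (exchange_big_dep predT) //=.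
rewrite (bigD1_seq g) ?divisors_uniq -?dvdn_divisors //=.
have inner b : (0 < b)%N ->
  \sum_(a <- divisors n | (a * b %| g)%N) (mobius a)%:~R * h b
    = (b == g)%:R * h b.
  move=> b0; rewrite -mulr_suml; congr (_ * _).
  have [bg|bg] := boolP (b %| g)%N; last first.
    rewrite big1 => [|a abg]; last first.
      by case/negP: bg; apply: dvdn_trans abg; apply: dvdn_mull.
    by case: eqP bg => // ->; rewrite dvdnn.
  have gb0 : (0 < g %/ b)%N by rewrite divn_gt0 // dvdn_leq.
  rewrite -big_filter (perm_big (divisors (g %/ b))) /=; last first.
    apply: uniq_perm; rewrite ?filter_uniq ?divisors_uniq // => a.
    rewrite mem_filter -!dvdn_divisors // -{1}(divnK bg) dvdn_pmul2r //.
    apply: andb_idr => /dvdn_trans; apply.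
    by apply: dvdn_trans gn; apply: dvdn_div.
  rewrite -(rmorph_sum (intr : int -> A)) sum_mobius_divisors //= natz.
  by rewrite -(eqn_pmul2r b0) divnK // mul1n eq_sym.
rewrite inner // eqxx mul1r big_seq_cond big1 ?addr0 // => b /andP[].
rewrite -dvdn_divisors // => /(dvdn_gt0 n0) b0 /negPf bg.
by rewrite inner // bg mul0r.
Qed.

(** * Periodic functions on the integers, and lifting units mod d to units mod n *)

Lemma sum_shift_period (A : nmodType) (n : nat) (F : int -> A) :
  (forall k, F (k + n%:Z) = F k) ->
  \sum_(1 <= k < n.+1) F k%:Z = \sum_(k < n) F k%:Z.
Proof.
move=> per; case: n per => [|n] per; first by rewrite big_nil big_ord0.
by rewrite big_nat_recr //= big_ord_recl addrC -(per 0) add0r big_add1 big_mkord.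
Qed.

Lemma periodic_mod (A : Type) (n : nat) (F : int -> A) :
  (forall k, F (k + n%:Z) = F k) ->
  forall j k : int, (n%:Z %| j - k)%Z -> F j = F k.
Proof.
move=> per j k /dvdzP[q /eqP]; rewrite subr_eq => /eqP ->.
have perN (m : nat) i : F (i + m%:Z * n%:Z) = F i.
  elim: m i => [|m IH] i; first by rewrite mul0r addr0.
  by rewrite intS mulrDl mul1r addrCA addrC per IH.
case: q => m; first by rewrite addrC perN.
by rewrite NegzE mulNr addrC -(perN m.+1) subrK.
Qed.

(** Multiplication by a unit c permutes the residues mod n. *)
Lemma sum_periodic_unitM (A : nmodType) (n : nat) (F : int -> A) (c : int) :
  (forall k, F (k + n%:Z) = F k) -> coprimez c n%:Z ->
  \sum_(k < n) F (c * k%:Z) = \sum_(k < n) F k%:Z.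
Proof.
case: n => [|n] per cn; first by rewrite !big_ord0.
(* The remainder lies between 0 and n, so neither the absolute value nor the default of [inord]
   changes it. *)
pose h (i : 'I_n.+1) : 'I_n.+1 := inord `|(c * i%:Z %% n.+1%:Z)%Z|.
have hE i : (h i)%:Z = (c * i%:Z %% n.+1%:Z)%Z.
  have ge0 : 0 <= (c * i%:Z %% n.+1%:Z)%Z by rewrite modz_ge0.
  rewrite inordK ?gez0_abs // -ltz_nat gez0_abs //.
  by rewrite ltz_pmod.
have h_inj : injective h.
  move=> i j /(congr1 (fun k : 'I_n.+1 => k%:Z)); rewrite !hE => /eqP.
  rewrite eqz_mod_dvd -mulrBr Gauss_dvdzr; last by rewrite coprimez_sym.
  rewrite -eqz_mod_dvd => /eqP; rewrite !modz_small ?ltz_nat ?ltn_ord //.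
  by case=> /val_inj.
rewrite [RHS](reindex_inj h_inj) /=; apply: eq_bigr => i _.
by apply: (periodic_mod per); rewrite hE -eqz_mod_dvd modz_mod.
Qed.

(* Adding to k the multiple of d by the primes of n not dividing k:
   a prime of n divides exactly one of k and that product. *)
Definition coprime_lift (n d : nat) (k : int) : int :=
  k + d%:Z * (\prod_(p <- primes n | ~~ (p %| `|k|)) p)%N%:Z.

Lemma coprime_liftP (n d : nat) (k : int) : (0 < n)%N -> coprimez k d%:Z ->
  coprimez (coprime_lift n d k) n%:Z.
Proof.
move=> n0 kd; rewrite /coprimez /= eqz_nat -[X in gcdn _ X]/n.
apply: contraT => g1; set g := gcdn _ _ in g1.
have g0 : (0 < g)%N by rewrite gcdn_gt0 n0 orbT.
have pp : prime (pdiv g) by rewrite pdiv_prime // ltn_neqAle eq_sym g1.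
have := pdiv_dvd g; move: (pdiv g) pp => p pp; rewrite dvdn_gcd => /andP[px pn].
have {}px : (p%:Z %| coprime_lift n d k)%Z by [].
have pP : (p \in primes n) by rewrite mem_primes pp n0.
(* If p divides k, it must divide d, against k being prime to d, or equal a prime of the product,
   none of which divides k. *)
have [pk|pk] := boolP (p %| `|k|)%N.
  move: px; rewrite rpredDl // => pdm.
  have {pdm} : (p %| d * \prod_(q <- primes n | ~~ (q %| `|k|)) q)%N by [].
  rewrite Euclid_dvdM // => /orP[pd|].
    have : (p %| gcdn `|k| d)%N by rewrite dvdn_gcd pk.
    by have /eqP[->] := kd; rewrite Euclid_dvd1.
  rewrite Euclid_dvd_prod // big_has_cond => /hasP[q].
  rewrite mem_primes => /and3P[pq _ _].
  by case/andP=> qk; rewrite dvdn_prime2 // => /eqP pq'; rewrite -pq' pk in qk.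
(* Otherwise p is a factor of the product, so dividing the lift forces it to divide k. *)
have /negP[] := pk; suff : (p%:Z %| k)%Z by [].
move: px; rewrite rpredDr // dvdz_mull //.
by rewrite dvdzE /= (big_rem p) //= pk dvdn_mulr.
Qed.

(** * Descent of a character to a divisor of its modulus, and its sums over progressions *)

Section DirichletCharacter.

Variables (R : realType) (n : nat) (chi : int -> R[i]).
Hypotheses (n_gt0 : (0 < n)%N) (chiD : dirichlet_character n chi).

Lemma character_periodic k : chi (k + n%:Z) = chi k.
Proof. by case: chiD. Qed.

Lemma characterM j k : chi (j * k) = chi j * chi k.
Proof. by case: chiD. Qed.

Lemma character_neq0 k : coprimez k n%:Z -> chi k != 0.
Proof. by case: chiD => _ _ h /h. Qed.

(** With u an inverse of y mod n, both [x * u] and [y * u] are units congruent to 1 mod d, so [chi]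
    is 1 on both, and [chi u] cancels. *)
Lemma character_eq_mod (d : nat) :
  (d %| n)%N ->
  (forall c, coprimez c n%:Z -> (d%:Z %| c - 1)%Z -> chi c = 1) ->
  forall x y, coprimez x n%:Z -> coprimez y n%:Z -> (d%:Z %| x - y)%Z ->
  chi x = chi y.
Proof.
move=> dn triv x y xn yn xy.
have /coprimezP[[u v] /= uv] := yn.
have un : coprimez u n%:Z.
  by apply/coprimezP; exists (y, v); rewrite /= mulrC.
have dyu : (d%:Z %| y * u - 1)%Z.
  rewrite -uv mulrC opprD addNKr -mulNr dvdz_mull //.
have dxu : (d%:Z %| x * u - 1)%Z.
  by rewrite -(subrK (y * u) (x * u)) -addrA -mulrBl rpredD // dvdz_mulr.
apply: (mulIf (character_neq0 un)).
by rewrite -!characterM !triv // coprimezMl ?xn ?yn.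
Qed.

(** On units mod n, [chi] depends only on the class mod d, and every unit mod d lifts to a unit mod
    n; evaluating [chi] at a lift defines the inducing character. *)
Lemma character_descend (d : nat) :
  (d %| n)%N ->
  (forall c, coprimez c n%:Z -> (d%:Z %| c - 1)%Z -> chi c = 1) ->
  exists2 psi : int -> R[i], dirichlet_character d psi & induced_by n chi psi.
Proof.
move=> dn triv; have chi_mod := character_eq_mod dn triv.
pose psi k := if coprimez k d%:Z then chi (coprime_lift n d k) else 0.
(* Any lift computes [psi], so each axiom is checked on a convenient one, such as a product of lifts
   for multiplicativity. *)
have psiE k x : coprimez k d%:Z -> coprimez x n%:Z -> (d%:Z %| x - k)%Z ->
    psi k = chi x.
  move=> kd xn xk; rewrite /psi kd; apply: chi_mod; rewrite ?coprime_liftP //.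
  rewrite /coprime_lift addrAC rpredD ?dvdz_mulr //.
  by rewrite -opprB rpredN.
have lift_mod k : (d%:Z %| coprime_lift n d k - k)%Z.
  by rewrite /coprime_lift addrAC subrr add0r dvdz_mulr.
exists psi; last first.
  move=> k kn; rewrite (psiE k k) ?subrr ?dvdz0 //.
  exact: coprimez_dvdr kn.
split=> [k|j k|k].
- have [kd|kd] := boolP (coprimez k d%:Z); last first.
    by rewrite /psi (negPf kd) /coprimez gcdzC gcdzDr gcdzC -/(coprimez k d%:Z) (negPf kd).
  rewrite [RHS](psiE k (coprime_lift n d k)) ?coprime_liftP //.
  apply: psiE; rewrite ?coprime_liftP //.
  + by rewrite /coprimez gcdzC gcdzDr gcdzC.
  + by rewrite opprD addrA rpredB.
- have [jd|jd] := boolP (coprimez j d%:Z); last first.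
    by rewrite /psi coprimezMl (negPf jd) mul0r.
  have [kd|kd] := boolP (coprimez k d%:Z); last first.
    by rewrite /psi coprimezMl (negPf kd) andbF mulr0.
  rewrite (psiE j _ jd (coprime_liftP n_gt0 jd)) //.
  rewrite (psiE k _ kd (coprime_liftP n_gt0 kd)) //.
  rewrite -characterM; apply: psiE; rewrite ?coprimezMl ?jd ?coprime_liftP //.
  have mulB (x y : int) : x * y - j * k = (x - j) * y + j * (y - k).
    by rewrite mulrBl mulrBr addrA subrK.
  by rewrite mulB; apply: rpredD; [apply: dvdz_mulr | apply: dvdz_mull].
- rewrite /psi; case: ifPn => kd; last by rewrite eqxx.
  by split=> // _; apply: character_neq0; apply: coprime_liftP.
Qed.

(** As c is 1 mod d, replacing k by [c * k] preserves the congruence to s mod d and multiplies the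
    sum by [chi c], which differs from 1. *)
Lemma sum_character_progression (d : nat) (s : int) (c : int) :
  (d %| n)%N -> coprimez c n%:Z -> (d%:Z %| c - 1)%Z -> chi c != 1 ->
  \sum_(k < n) (d%:Z %| k%:Z - s)%Z%:R * chi k%:Z = 0.
Proof.
move=> dn cn c1 chi_c; pose F k := (d%:Z %| k - s)%Z%:R * chi k.
have perF k : F (k + n%:Z) = F k.
  by rewrite /F character_periodic addrAC rpredDr.
have FM k : F (c * k) = chi c * F k.
  rewrite /F characterM mulrCA; congr (_ * _).
  have -> : c * k - s = (c - 1) * k + (k - s) by rewrite mulrBl mul1r addrA subrK.
  by rewrite rpredDl // dvdz_mulr.
have /eqP := sum_periodic_unitM perF cn.
under eq_bigr => i _ do rewrite FM.
rewrite -mulr_sumr -subr_eq0 -{2}[\sum_(_ < n) _]mul1r -mulrBl mulf_eq0 subr_eq0.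
by rewrite (negPf chi_c) => /eqP.
Qed.

Lemma sum_character_residue (s : int) :
  \sum_(k < n) (n%:Z %| k%:Z - s)%Z%:R * chi k%:Z = chi s.
Proof.
have n0 : n%:Z != 0 by rewrite eqz_nat -lt0n.
pose r := `|(s %% n%:Z)%Z|%N.
have rE : r%:Z = (s %% n%:Z)%Z by rewrite gez0_abs // modz_ge0.
have rn : (r < n)%N by rewrite -ltz_nat rE ltz_pmod.
rewrite (bigD1 (Ordinal rn)) //= big1 => [|k kr].
  rewrite addr0 -eqz_mod_dvd rE modz_mod eqxx mul1r.
  by apply: (periodic_mod character_periodic); rewrite -eqz_mod_dvd modz_mod.
rewrite -eqz_mod_dvd -rE modz_small ?ltz_nat ?ltn_ord //.
by rewrite eqz_nat -[_ == r]/(k == Ordinal rn) (negPf kr) mul0r.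
Qed.

End DirichletCharacter.

(** * Primitive characters and the convolution identity *)

(** For d < n, a nonzero sum would force [chi c = 1] at every unit c congruent to 1 mod d; [chi]
    would then descend to d, against primitivity. *)
Lemma sum_primitive_progression (R : realType) (n d : nat) (chi : int -> R[i])
    (s : int) :
  (0 < n)%N -> primitive_character n chi -> (d %| n)%N ->
  \sum_(k < n) (d%:Z %| k%:Z - s)%Z%:R * chi k%:Z = (d == n)%:R * chi s.
Proof.
move=> n0 [chiD prim] dn; have [->|d_neq_n] := eqVneq d n.
  by rewrite sum_character_residue // mul1r.
have d_lt_n : (d < n)%N by rewrite ltn_neqAle d_neq_n dvdn_leq.
rewrite mul0r; apply/eqP; apply: contraT => sum_neq0.
have [c cn c1|psi psiD chi_psi] := character_descend n0 chiD dn.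
  apply/eqP; apply: contraNT sum_neq0 => chi_c.
  by rewrite (sum_character_progression chiD s dn cn c1 chi_c).
by case: (prim d psi dn d_lt_n psiD).
Qed.

Theorem theorem2p7 (R : realType) (n : nat) (chi f : int -> R[i]) (s : int)
    (hn : (0 < n)%N) (hchi : primitive_character n chi) (hf : even_mod n f) :
  \sum_(1 <= k < n.+1) f (k%:Z - s) * chi k%:Z =
  dirichlet_conv (fun m : nat => (mobius m)%:~R) (fun m : nat => f m%:Z) n
    * chi s.
Proof.
(* Evenness makes f periodic mod n, since [k + n - s] and [k - s] have the same gcd with n. *)
have per k : f (k + n%:Z - s) * chi (k + n%:Z) = f (k - s) * chi k.
  rewrite (character_periodic hchi.1); congr (_ * _).
  by rewrite -hf -[RHS]hf addrAC gcdzC gcdzDr gcdzC.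
rewrite (sum_shift_period per) => {per}.
pose g (k : int) := gcdn `|k - s| n.
have fE k : f (k - s) = \sum_(a <- divisors n) \sum_(b <- divisors n)
    (a * b %| g k)%N%:R * ((mobius a)%:~R * f b%:Z).
  rewrite -hf [LHS](mobius_expand (fun m => f m%:Z) hn (dvdn_gcdr _ _)).
  apply: eq_bigr => a _; rewrite big_mkcond; apply: eq_bigr => b _.
  by case: ifP; rewrite ?mul1r ?mul0r.
under eq_bigr => k _ do rewrite fE mulr_suml.
rewrite exchange_big /dirichlet_conv mulr_suml /=.
rewrite [LHS]big_seq [RHS]big_seq; apply: eq_bigr => a.
rewrite -dvdn_divisors // => an; have a0 := dvdn_gt0 hn an.
under eq_bigr => k _ do rewrite mulr_suml.
rewrite exchange_big /=.
(* Dividing [g k] means dividing both n and [k - s], so the k-sum is the progression sum for the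
   divisor [a * b] of n, nonzero only if a * b = n. *)
have inner b : \sum_(k < n) (a * b %| g k)%N%:R *
    ((mobius a)%:~R * f b%:Z) * chi k%:Z
    = (b == n %/ a)%N%:R * ((mobius a)%:~R * f b%:Z * chi s).
  (* If [a * b] does not divide n, both sides vanish, because b = n / a would give a * b = n. *)
  have [abn|abn] := boolP (a * b %| n)%N; last first.
    rewrite big1 => [|k _]; last first.
      by rewrite dvdn_gcd (negPf abn) andbF !mul0r.
    by case: eqP abn => [->|_]; rewrite ?mul0r // mulnC divnK // dvdnn.
  rewrite mulrCA -[n in (b == n %/ a)%N](divnK an).
  rewrite -(@eqn_pmul2l a) // [in RHS]mulnC mulnK // [(a * (n %/ a))%N]mulnC divnK //.
  rewrite mulnC in abn *; rewrite -(sum_primitive_progression s hn hchi abn).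
  rewrite mulr_sumr; apply: eq_bigr => k _.
  rewrite /g dvdn_gcd abn andbT -mulrA mulrCA; congr (_ * _).
under eq_bigr => b _ do rewrite inner.
rewrite (bigD1_seq (n %/ a)%N) ?divisors_uniq -?dvdn_divisors ?dvdn_div //=.
rewrite eqxx mul1r big1 ?addr0 // => b /negPf ->; exact: mul0r.
Qed.
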